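(* Let $X$ be a non-negative random variable with CDF $F$ which is DDA, i.e. its quantile function $F^{-1}$ is star-shaped: $p\mapsto F^{-1}(p)/p$ is increasing on $(0,1)$. Let $1\le i\le n$ and $1\le j\le m$ be integers and define, for $x\in[0,1]$, $$Z(x)=\frac{i}{n+1}\left(1-F_{B_{i+1:n+1}}(x)\right)-\frac{j}{m+1}\left(1-F_{B_{j+1:m+1}}(x)\right),$$ where $F_{B_{k:N}}$ denotes the CDF of the $\mathrm{beta}(k,N-k+1)$ distribution. Let $R$ be the set of solutions $x\in(0,1)$ of the equation $$x^{\,i-j}(1-x)^{(n-i)-(m-j)}=\frac{\mathcal{B}(i,n-i+1)}{\mathcal{B}(j,m-j+1)},$$ where $\mathcal{B}$ is the beta function. If $Z(r)\geq 0$ for every $r\in R$, then $X_{i:n}\geq_{ss}X_{j:m}$.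
   Context: $F^{-1}(p)=\inf\{x:F(x)\ge p\}$. $X_{k:N}$ is the $k$-th order statistic of an i.i.d. sample of size $N$ from $F$. A function $u:[0,\infty)\to[0,\infty)$ with $u(0)=0$ is star-shaped if $u(x)/x$ is increasing on $(0,\infty)$. For non-negative random variables $V,W$, $V\geq_{ss}W$ means $\mathbb{E}\,u(V)\geq\mathbb{E}\,u(W)$ for every star-shaped $u$ for which the expectations exist. ''Increasing'' means non-decreasing. *)

(* Defs.v *)
From HB Require Import structures.
From mathcomp Require Import all_boot all_order all_algebra.
From mathcomp Require Import all_classical all_reals all_analysis.
Set Implicit Arguments. Unset Strict Implicit. Unset Printing Implicit Defensive.
Import Order.TTheory GRing.Theory Num.Theory.
Import numFieldTopology.Exports.
Local Open Scope classical_set_scope.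
Local Open Scope ring_scope.

Section defs.
Context {R : realType}.

Definition quantile (F : R -> R) (p : R) : R := inf [set x | p <= F x].

Definition DDA (F : R -> R) : Prop :=
  forall p q, 0 < p -> p <= q -> q < 1 -> quantile F p / p <= quantile F q / q.

(* star-shaped u : [0,oo) -> [0,oo), u 0 = 0, u(x)/x increasing on (0,oo);
   values of u on negative reals are irrelevant *)
Definition star_shaped (u : R -> R) : Prop :=
  [/\ u 0 = 0, (forall x, 0 <= x -> 0 <= u x) &
      (forall x y, 0 < x -> x <= y -> u x / x <= u y / y)].

Definition mutually_independent d (T : measurableType d) (P : probability T R)
    (n : nat) (Xs : 'I_n -> {RV P >-> R}) : Prop :=
  forall (J : {set 'I_n}) (B : 'I_n -> set R),
    (forall k, measurable (B k)) ->
    P (\bigcap_(k in [set k | k \in J]) (Xs k @^-1` B k)) =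
    (\prod_(k in J) P (Xs k @^-1` B k))%E.

Definition iid_sample d (T : measurableType d) (P : probability T R)
    (n : nat) (Xs : 'I_n -> {RV P >-> R}) (F : R -> R) : Prop :=
  mutually_independent Xs /\ forall k x, fine (cdf (Xs k) x) = F x.

(* k-th order statistic (k is 1-based) *)
Definition order_stat T (n : nat) (Xs : 'I_n -> T -> R) (k : nat) (w : T) : R :=
  nth 0 (sort <=%R [seq Xs l w | l <- enum 'I_n]) k.-1.

Definition beta_cdf (k N : nat) (x : R) : R :=
  fine (beta_prob k (N - k + 1) `]-oo, x]).

Definition Zfun (n m i j : nat) (x : R) : R :=
  i%:R / n.+1%:R * (1 - beta_cdf i.+1 n.+1 x)
  - j%:R / m.+1%:R * (1 - beta_cdf j.+1 m.+1 x).

(* V >=_ss W, for V, W non-negative, possibly on different spaces;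
   quantified over star-shaped u for which both expectations exist (finite) *)
Definition ss_ge d1 (T1 : measurableType d1) (P1 : probability T1 R) (V : T1 -> R)
    d2 (T2 : measurableType d2) (P2 : probability T2 R) (W : T2 -> R) : Prop :=
  forall u : R -> R, star_shaped u ->
    P1.-integrable setT (fun w => (u (V w))%:E) ->
    P2.-integrable setT (fun w => (u (W w))%:E) ->
    (\int[P2]_w (u (W w))%:E <= \int[P1]_w (u (V w))%:E)%E.

End defs.

(* Main.v *)
(** Write [X_{i:n}] as [F^{-1}(B)] with [B] of law beta(i, n-i+1), and put
    [h(p) = u(F^{-1}(p)) / p], which is non-decreasing on (0,1) because both [u]
    and [F^{-1}] are star-shaped. As [p] times the beta(i, n-i+1) density is
    [i/(n+1)] times the beta(i+1, n-i+1) density,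
    [E u(X_{i:n}) = i/(n+1) * E h(B')] with [B'] of law beta(i+1, n-i+1). The
    superlevel sets of [h] are the intervals (x,1) or [x,1), so by the
    layer-cake formula it suffices that [Z >= 0] on [0,1].

    Since [Z'(x) = - x D(x)], where [D] is the difference of the two beta
    densities, the interior critical points of [Z] are exactly the solutions, so
    [Z >= 0] between any two points where [Z >= 0]. By Rolle there is a solution
    [c], and [Z 1 = 0], so [Z >= 0] on [c,1]. If [n-i > m-j], then [D < 0] near
    1, hence [Z < 0] just before 1, which is impossible. If [i < j], then
    [D > 0] near 0, so [Z] decreases there and cannot attain a negative minimum
    over [0,c] at 0. In the remaining case [Z 0 = i/(n+1) - j/(m+1) >= 0] by
    arithmetic. *)
Require Import Defs.
From HB Require Import structures.
From mathcomp Require Import all_boot all_order all_algebra.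
From mathcomp Require Import all_classical all_reals all_analysis.
From mathcomp Require Import measurable_realfun.
From mathcomp Require Import ring lra zify.
Set Implicit Arguments. Unset Strict Implicit. Unset Printing Implicit Defensive.
Import Order.TTheory GRing.Theory Num.Theory.
Import numFieldNormedType.Exports.
Local Open Scope classical_set_scope.
Local Open Scope ring_scope.

(** * Binomial tails *)

Section binomial_tail.
Context {R : comNzRingType}.

(** Probability that a binomial(N, x) variable is at least [k]; for [0 < k <= N] this is also the
    CDF of beta(k, N-k+1) on [0,1]. As a polynomial it is differentiated algebraically. *)
Definition binomial_tail (k N : nat) : {poly R} :=
  \sum_(k <= l < N.+1) 'C(N, l)%:R *: ('X^l * (1 - 'X) ^+ (N - l)).

Lemma binomial_tail_horner k N (x : R) :
  (binomial_tail k N).[x] =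
  \sum_(k <= l < N.+1) 'C(N, l)%:R * (x ^+ l * (1 - x) ^+ (N - l)).
Proof.
rewrite /binomial_tail horner_sum; apply: eq_bigr => l _.
by rewrite !hornerE.
Qed.

Lemma binomial_tail_horner0 k N : (0 < k)%N -> (binomial_tail k N).[0] = 0.
Proof.
move=> k0; rewrite binomial_tail_horner big_nat_cond big1// => l.
move=> /andP[/andP[kl _] _]; rewrite expr0n.
by case: l kl => [|l _]; [lia|rewrite /= mul0r mulr0].
Qed.

Lemma binomial_tail_horner1 k N : (k <= N)%N -> (binomial_tail k N).[1] = 1.
Proof.
move=> kN; rewrite binomial_tail_horner big_nat_recr//= big_nat_cond big1.
  by rewrite add0r binn subnn expr0 expr1n !mulr1.
move=> l /andP[/andP[_ lN] _]; rewrite subrr expr0n.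
by have -> : (N - l == 0)%N = false by [lia]; rewrite mulr0 mulr0.
Qed.

(** The derivatives of consecutive summands telescope and only the lower boundary term survives. It
    is the beta(k, N-k+1) density, as [k * 'C(N, k)] is the inverse of the beta function. *)
Lemma deriv_binomial_tail (k N : nat) : (0 < k <= N)%N ->
  (binomial_tail k N)^`() =
  (k * 'C(N, k))%:R *: ('X^(k.-1) * (1 - 'X) ^+ (N - k)).
Proof.
move=> /andP[k0 kN]; move: k0.
have dN : (1 - 'X : {poly R})^`() = -1 by rewrite derivB derivX derivC sub0r.
(* Downward induction on [k] from [N]: each step adds one summand at the bottom. *)
rewrite -(subKn kN); set e := (N - k)%N; have : (e <= N)%N by rewrite leq_subr.
elim: e => [|e IH] eN e0.
  rewrite subn0 /binomial_tail big_nat1 subnn binn muln1 !expr0 !mulr1.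
  by rewrite scale1r derivXn scaler_nat.
rewrite /binomial_tail big_ltn; last by lia.
rewrite derivD.
have -> : (N - e.+1).+1 = (N - e)%N by lia.
rewrite -/(binomial_tail _ _) IH; [|lia|lia].
set s := (N - e.+1)%N.
have -> : (N - e)%N = s.+1 by rewrite /s; lia.
have -> : (N - s)%N = e.+1 by rewrite /s; lia.
have -> : (N - s.+1)%N = e by rewrite /s; lia.
(* With this identity the boundary term of the induction hypothesis cancels against the derivative
   of the [1 - 'X] factor of the new summand. *)
have -> : (s.+1 * 'C(N, s.+1) = e.+1 * 'C(N, s))%N.
  by rewrite mul_bin_left /s; congr (_ * _)%N; lia.
rewrite derivZ derivM derivXn deriv_exp dN /= !scaler_nat.
rewrite -(mulr_natr _ (e.+1 * _)) -(mulr_natr _ (s * _)) -(mulr_natr _ 'C(N, s)).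
rewrite -(mulr_natr _ s) -(mulr_natr _ e.+1) !natrM.
by ring.
Qed.

End binomial_tail.

(** * Non-negativity of the gap function *)

Section polynomial_calculus.
Context {R : realType}.
Implicit Types (p : {poly R}) (a b x : R).

Lemma poly_MVT p a b : a < b ->
  exists2 c, a < c < b & p.[b] - p.[a] = p^`().[c] * (b - a).
Proof.
move=> ab.
have dp x : x \in `]a, b[%R -> is_derive x 1 (horner p) p^`().[x].
  by move=> _; exact: is_derive_poly.
have cp : {within `[a, b], continuous (horner p)}.
  by apply: continuous_subspaceT; exact: continuous_horner.
have [c] := MVT ab dp cp.
by rewrite in_itv /= => cab ?; exists c.
Qed.

Lemma poly_gt0_near p a : 0 < p.[a] ->
  exists2 e, 0 < e & forall x, `|a - x| < e -> 0 < p.[x].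
Proof.
move=> pa; have /cvgrPdist_lt/(_ _ pa) := @continuous_horner R p a.
move=> /nbhs_ballP[e /= e0 he]; exists e => // x xe.
by have /= := he x xe; rewrite ltr_norml => /andP[_]; lra.
Qed.

(** A minimiser over [a,b] has value at most [p.[x]], hence below both endpoint values, so it is
    interior and critical. *)
Lemma poly_interior_min p a b x : a <= x <= b ->
  p.[x] < p.[a] -> p.[x] < p.[b] ->
  exists2 c, a < c < b & p^`().[c] = 0 /\ p.[c] <= p.[x].
Proof.
move=> /andP[ax xb] pxa pxb; have ab := le_trans ax xb.
have [|c] := @EVT_min R (horner p) a b ab.
  by apply: continuous_subspaceT; exact: continuous_horner.
rewrite in_itv /= => /andP[ac cb] cmin.
have pcx : p.[c] <= p.[x] by apply: cmin; rewrite in_itv /= ax.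
have {}ac : a < c.
  by rewrite lt_neqAle ac andbT; apply: contraTneq pcx => <-; rewrite -ltNge.
have {}cb : c < b.
  by rewrite lt_neqAle cb andbT; apply: contraTneq pcx => ->; rewrite -ltNge.
exists c; first by rewrite ac.
split=> //; rewrite derivE derive1E.
apply: (@derive_val _ _ _ _ _ _ _ (@derive1_at_min R (horner p) a b c ab _ _ _)).
- by move=> t _; exact: derivable_horner.
- by rewrite in_itv /= ac.
- move=> t; rewrite in_itv /= => /andP[/ltW ta /ltW tb].
  by apply: cmin; rewrite in_itv /= ta.
Qed.

End polynomial_calculus.

Section tail_moment_gap.
Context {R : realType}.
Implicit Types (i j n m : nat) (x : R).

(** Size biasing: a factor ['X] raises the first beta parameter by one, and i/(n+1) is the mean of
    beta(i, n-i+1). *)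
Lemma scale_deriv_binomial_tail n i : (0 < i <= n)%N ->
  (i%:R / n.+1%:R) *: (binomial_tail i.+1 n.+1)^`() =
  'X * (binomial_tail i n)^`() :> {poly R}.
Proof.
move=> /andP[i0 ilen].
rewrite !deriv_binomial_tail ?i0 ?ltnS// subSS -pred_Sn scalerA.
rewrite -scalerAr mulrA -exprS prednK// -mul_bin_diag -pred_Sn.
by rewrite !natrM mulrA divfK// pnatr_eq0.
Qed.

(** Polynomial form of [Zfun] on [0,1]. By size biasing it is the difference of the truncated means
    E[B; B > x] for the laws beta(i, n-i+1) and beta(j, m-j+1). *)
Definition tail_moment_gap n m i j : {poly R} :=
  (i%:R / n.+1%:R) *: (1 - binomial_tail i.+1 n.+1)
  - (j%:R / m.+1%:R) *: (1 - binomial_tail j.+1 m.+1).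

Lemma deriv_tail_moment_gap n m i j : (0 < i <= n)%N -> (0 < j <= m)%N ->
  (tail_moment_gap n m i j)^`() =
  - 'X * ((binomial_tail i n)^`() - (binomial_tail j m)^`()).
Proof.
move=> hi hj; rewrite /tail_moment_gap derivB !derivZ !derivB derivC !sub0r.
by rewrite !scalerN !scale_deriv_binomial_tail//; ring.
Qed.

Lemma tail_moment_gap_ge0 n m i j : (0 < i <= n)%N -> (0 < j <= m)%N ->
  (forall r, 0 < r < 1 ->
     (binomial_tail i n)^`().[r] = (binomial_tail j m)^`().[r] ->
     0 <= (tail_moment_gap n m i j).[r]) ->
  forall x, 0 <= x <= 1 -> 0 <= (tail_moment_gap n m i j).[x].
Proof.
move=> hi hj hcrit; have [/andP[i0 ilen] /andP[j0 jlem]] := (hi, hj).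
set Z := tail_moment_gap n m i j.
set f : {poly R} := binomial_tail i n - binomial_tail j m.
pose A : R := (i * 'C(n, i))%:R; pose B : R := (j * 'C(m, j))%:R.
have A0 : 0 < A by rewrite ltr0n muln_gt0 i0 bin_gt0.
have B0 : 0 < B by rewrite ltr0n muln_gt0 j0 bin_gt0.
have dfE x : f^`().[x] = A * (x ^+ i.-1 * (1 - x) ^+ (n - i)) -
    B * (x ^+ j.-1 * (1 - x) ^+ (m - j)).
  by rewrite /f derivB !deriv_binomial_tail// !hornerE.
have dZE x : Z^`().[x] = - x * f^`().[x].
  by rewrite /Z deriv_tail_moment_gap// /f derivB !hornerE.
have crit c : 0 < c < 1 -> Z^`().[c] = 0 -> 0 <= Z.[c].
  move=> c01; rewrite dZE => /eqP; rewrite mulf_eq0 oppr_eq0 gt_eqF /=; last lra.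
  rewrite /f derivB hornerD hornerN subr_eq0 => /eqP.
  exact: hcrit.
have Z1 : Z.[1] = 0.
  by rewrite /Z /tail_moment_gap !hornerE !binomial_tail_horner1//; ring.
have between a b x : 0 <= a -> b <= 1 -> 0 <= Z.[a] -> 0 <= Z.[b] ->
    a <= x <= b -> 0 <= Z.[x].
  move=> a0 b1 Za Zb axb; rewrite leNgt; apply/negP => Zx.
  have [|c acb [dZc Zcx]] := poly_interior_min axb (lt_le_trans Zx Za).
    exact: lt_le_trans Zx Zb.
  have : 0 <= Z.[c] by apply: crit => //; lra.
  by lra.
(* Rolle: the two CDFs agree at 0 and at 1. *)
have [c c01 dfc] : exists2 c, 0 < c < 1 & f^`().[c] = 0.
  have [c c01] := poly_MVT f (@ltr01 R).
  have -> : f.[1] = 0 by rewrite /f !hornerE !binomial_tail_horner1// subrr.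
  have -> : f.[0] = 0 by rewrite /f !hornerE !binomial_tail_horner0// subrr.
  by move=> h; exists c => //; lra.
have Zc : 0 <= Z.[c] by apply: crit => //; rewrite dZE dfc mulr0.
suff Z0 : 0 <= Z.[0] by move=> x; apply: (between 0 1); rewrite ?Z1.
rewrite leNgt; apply/negP => Z0.
have [ij|ji] := ltnP i j.
  (* Cofactor of x^(i-1) in the difference of densities. Since [i < j], its value at 0 is [A > 0],
     which fixes the sign near 0. *)
  pose E : {poly R} := A *: (1 - 'X) ^+ (n - i) -
    B *: ('X^(j - i) * (1 - 'X) ^+ (m - j)).
  have dfE0 x : f^`().[x] = x ^+ i.-1 * E.[x].
    rewrite dfE /E !hornerE; have -> : j.-1 = (i.-1 + (j - i))%N by lia.
    by rewrite exprD /=; ring.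
  have [|e e0 Ee] := @poly_gt0_near R E 0.
    rewrite /E !hornerE subr0 !expr1n expr0n.
    have -> : (j - i == 0)%N = false by [lia].
    by rewrite /= !(mulr0, mul0r, mulr1, subr0).
  have [y [y0 ye yc]] : exists y, [/\ 0 < y, y < e & y < c].
    by exists (Num.min e c / 2); split; case: (ltP e c) => ec; lra.
  have [t ty] := poly_MVT Z y0; rewrite dZE dfE0 subr0 => hZ.
  have Et : 0 < E.[t] by apply: Ee; rewrite sub0r normrN gtr0_norm; lra.
  have Zy0 : Z.[y] < Z.[0].
    have t0 : 0 < t by lra.
    rewrite -subr_lt0 hZ !mulNr oppr_lt0.
    by rewrite !mulr_gt0 ?exprn_gt0.
  (* [Z.[y] < Z.[0] < 0 <= Z.[c]] forces an interior critical point with a negative value. *)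
  have [|||b b01 [dZb Zb]] := @poly_interior_min R Z 0 c y; [lra|lra|lra|].
  by have : 0 <= Z.[b] by [apply: crit => //; lra]; lra.
have [nm|mn] := ltnP (m - j) (n - i).
  (* Minus the cofactor of (1-x)^(m-j). Since [m - j < n - i], its value at 1 is [B > 0], so the
     difference of densities is negative just before 1. *)
  pose E : {poly R} := B *: 'X^(j.-1) -
    A *: ('X^(i.-1) * (1 - 'X) ^+ ((n - i) - (m - j))).
  have dfE1 x : f^`().[x] = - ((1 - x) ^+ (m - j) * E.[x]).
    rewrite dfE /E !hornerE.
    have {1}-> : (n - i = (m - j) + (n - i - (m - j)))%N by lia.
    by rewrite exprD /=; ring.
  have [|e e0 Ee] := @poly_gt0_near R E 1.
    rewrite /E !hornerE subrr !expr1n expr0n.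
    have -> : (n - i - (m - j) == 0)%N = false by [lia].
    by rewrite /= !(mulr0, mul0r, mulr1, subr0).
  have [d [d0 de dc]] : exists d, [/\ 0 < d, d < e & d < 1 - c].
    by exists (Num.min e (1 - c) / 2); split; case: (ltP e (1 - c)) => ec; lra.
  have d1 : 1 - d < 1 by lra.
  have [t ty] := poly_MVT Z d1; rewrite dZE dfE1 Z1 => hZ.
  have Et : 0 < E.[t] by apply: Ee; rewrite gtr0_norm; lra.
  have Zd : Z.[1 - d] < 0.
    rewrite -oppr_gt0 -[X in 0 < X]add0r hZ mulrNN.
    have [t0 t1] : 0 < t /\ 0 < 1 - t by lra.
    by rewrite opprB addrCA subrr addr0 !mulr_gt0 ?exprn_gt0.
  have : 0 <= Z.[1 - d] by apply: (between c 1); rewrite ?Z1//; lra.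
  by lra.
(* Now [j <= i] and [n - i <= m - j], and the claim at 0 amounts to j(n+1) <= i(m+1). *)
move: Z0; apply/negP; rewrite -leNgt /Z /tail_moment_gap !hornerE.
rewrite !binomial_tail_horner0// subr0 !mulr1 subr_ge0.
rewrite ler_pdivrMr ?ltr0n// mulrAC ler_pdivlMr ?ltr0n// -!natrM ler_nat.
by nia.
Qed.

End tail_moment_gap.

(** * Beta distributions *)

Section beta_measure.
Context {R : realType}.
Implicit Types (x y : R) (k N : nat).
Local Notation mu := (@lebesgue_measure R).

Lemma beta_funV k N : (0 < k <= N)%N ->
  (beta_fun k (N - k + 1))^-1 = (k * 'C(N, k))%:R :> R.
Proof.
case: k => // k /= kN; rewrite addn1 beta_fun_fact invf_div.
have -> : (k + (N - k.+1)).+1 = N by lia.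
rewrite -(bin_fact kN) factS
  (_ : ('C(N, k.+1) * _ = (k`! * (N - k.+1)`!) * (k.+1 * 'C(N, k.+1)))%N).
  2: by ring.
by rewrite (natrM _ (k`! * _)) mulrAC divff ?mul1r//.
Qed.

Lemma beta_pdfE k N x : (0 < k <= N)%N -> 0 <= x <= 1 ->
  beta_pdf k (N - k + 1) x = (binomial_tail k N)^`().[x].
Proof.
move=> kN x01; rewrite /beta_pdf patchE mem_set ?in_itv//= beta_funV//.
rewrite deriv_binomial_tail// /XMonemX addn1 /=.
by rewrite !hornerE /= -mulrA mulrC.
Qed.

Lemma beta_prob_setI01 k N (A : set R) : measurable A ->
  beta_prob k N A = beta_prob k N (A `&` `[0, 1]).
Proof.
move=> mA; rewrite /beta_prob /= /mscale /=; congr (_ * _)%E.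
by rewrite !integral_XMonemX_restrict -setIA setIid.
Qed.

(** The binomial tail is an antiderivative of the density. Both kinds of endpoints are covered
    because superlevel sets may be open or closed on the left. *)
Lemma beta_prob_itv k N (b b' : bool) x y : (0 < k <= N)%N ->
  0 <= x -> x < y -> y <= 1 ->
  beta_prob k (N - k + 1) [set` Interval (BSide b x) (BSide b' y)] =
  ((binomial_tail k N).[y] - (binomial_tail k N).[x])%:E.
Proof.
move=> kN x0 xy y1; rewrite -integral_beta_pdf//.
have mpdf A : measurable_fun A (EFin \o @beta_pdf R k (N - k + 1)).
  apply/measurable_funTS/measurable_EFinP; exact: measurable_beta_pdf.
rewrite integral_itv_bndoo// -(integral_itv_bndoo true false)//.
rewrite EFinB -(@continuous_FTC2 _ (horner (binomial_tail k N)^`())) //.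
- apply: eq_integral => z; rewrite inE /= in_itv /= => zxy.
  by rewrite beta_pdfE//; lra.
- by apply: continuous_subspaceT; exact: continuous_horner.
- split; first by move=> z _; exact: derivable_horner.
  + by apply: cvg_at_right_filter; exact: continuous_horner.
  + by apply: cvg_at_left_filter; exact: continuous_horner.
- by move=> z _; rewrite derivE.
Qed.

Lemma beta_prob_le k N x : (0 < k <= N)%N -> 0 <= x <= 1 ->
  beta_prob k (N - k + 1) `]-oo, x] = (binomial_tail k N).[x]%:E.
Proof.
move=> kN /andP[x0 x1]; rewrite beta_prob_setI01//.
have -> : `]-oo, x] `&` `[0, 1] = `[0, x]%classic :> set R.
  by apply/seteqP; split=> z /=; rewrite !in_itv /=; lra.
have /andP[k0 _] := kN.
(* At [x = 0] the interval is a single point, null by absolute continuity; [beta_prob_itv] asks for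
   distinct endpoints. *)
move: x0; rewrite le_eqVlt => /predU1P[<-|x0].
  rewrite set_itv1 binomial_tail_horner0//.
  have /null_content_dominatesP := @beta_prob_dom R k (N - k + 1).
  by apply => //; exact: lebesgue_measure_set1.
by rewrite beta_prob_itv// binomial_tail_horner0// subr0.
Qed.

(** The Radon-Nikodym derivative and [beta_pdf] have the same integral over every measurable set, so
    they agree almost everywhere. *)
Lemma ge0_integral_beta_prob a b (f : R -> \bar R) :
  measurable_fun setT f -> (forall x, 0 <= f x)%E ->
  (\int[beta_prob a b]_x f x = \int[mu]_x (f x * (beta_pdf a b x)%:E))%E.
Proof.
move=> mf f0; have ac := @beta_prob_dom R a b.
have mpdf : measurable_fun setT (EFin \o @beta_pdf R a b).
  by apply/measurable_EFinP; exact: measurable_beta_pdf.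
have RNint := Radon_Nikodym_SigmaFinite.f_integrable ac.
rewrite -(Radon_Nikodym_SigmaFinite.change_of_variables ac f0)//.
apply: ge0_ae_eq_integral => //.
- by apply: emeasurable_funM => //; exact: measurable_int RNint.
- exact: emeasurable_funM.
- by move=> x _; rewrite mule_ge0// Radon_Nikodym_SigmaFinite.f_ge0.
- by move=> x _; rewrite mule_ge0// lee_fin beta_pdf_ge0.
apply: ae_eqe_mul2l; apply: integral_ae_eq => //.
move=> E _ mE; rewrite -Radon_Nikodym_SigmaFinite.f_integral//.
by rewrite integral_beta_pdf.
Qed.

Lemma ge0_integral_beta_probX k N (h : R -> R) : (0 < k <= N)%N ->
  measurable_fun setT h -> (forall x, 0 <= x -> 0 <= h x) ->
  (forall x, x <= 0 -> h x = 0) ->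
  (\int[beta_prob k (N - k + 1)]_x (x * h x)%:E =
   (k%:R / N.+1%:R)%:E * \int[beta_prob k.+1 (N - k + 1)]_x (h x)%:E)%E.
Proof.
move=> kN mh h0 hn0.
have {}h0 x : 0 <= h x by case: (leP 0 x) => [/h0//|/ltW/hn0->].
have xh0 x : 0 <= x * h x.
  by case: (leP 0 x) => [?|/ltW/hn0->]; rewrite ?mulr0// mulr_ge0.
have mpdf a b : measurable_fun setT (EFin \o @beta_pdf R a b).
  by apply/measurable_EFinP; exact: measurable_beta_pdf.
have mEh : measurable_fun setT (EFin \o h) by exact/measurable_EFinP.
have mExh : measurable_fun setT (EFin \o (fun x => x * h x)).
  by apply/measurable_EFinP/measurable_funM.
rewrite (ge0_integral_beta_prob _ _ mExh)// (ge0_integral_beta_prob _ _ mEh)//.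
rewrite -ge0_integralZl//; last 2 first.
- exact: (emeasurable_funM mEh (mpdf k.+1 (N - k + 1)%N)).
- by move=> x _; rewrite mule_ge0// lee_fin// beta_pdf_ge0.
apply: eq_integral => x _; rewrite /= -!EFinM; congr EFin.
have [x01|x01] := boolP (0 <= x <= 1); last first.
  rewrite /beta_pdf !patchE memNset ?mul0r ?mulr0//=.
  by rewrite in_itv /=; exact/negP.
have kN1 : (0 < k.+1 <= N.+1)%N by case/andP: kN.
rewrite beta_pdfE// (@beta_pdfE k.+1 N.+1)//.
have /(congr1 (horner^~ x)) := @scale_deriv_binomial_tail R _ _ kN.
rewrite hornerZ hornerM hornerX => scale_x.
by rewrite (mulrC x) -mulrA -scale_x; ring.
Qed.

End beta_measure.

(** * Order statistics *)

Section order_statistics.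
Context {R : realType}.

(** In a sorted list the elements at most [t] form an initial segment. *)
Lemma sorted_nth_le (s : seq R) (t : R) k : sorted <=%R s -> (k < size s)%N ->
  (nth 0 s k <= t) = (k < count (fun x => (x <= t)%R) s)%N.
Proof.
elim: s k => [//|x s IH] k /= xs ks.
have [xt|tx] := leP x t.
  by case: k ks => [|k] ks; rewrite ?xt// IH// (path_sorted xs).
have gtt y : y \in x :: s -> (y <= t) = false.
  rewrite inE => /predU1P[->|ys]; apply/negbTE; rewrite -ltNge//.
  by rewrite (lt_le_trans tx)// (allP (order_path_min le_trans xs)).
rewrite add0n (gtt _ (mem_nth 0 _))// (_ : count _ s = 0%N)//.
apply/eqP; rewrite -leqn0 leqNgt -has_count; apply/negP => /hasP[y ys].
by rewrite gtt// inE ys orbT.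
Qed.

Lemma order_stat_le T n (Xs : 'I_n -> T -> R) k w t : (0 < k <= n)%N ->
  (order_stat Xs k w <= t) = (k <= #|[set l | (Xs l w <= t)%R]%SET|)%N.
Proof.
move=> /andP[k0 kn]; rewrite /order_stat sorted_nth_le; first last.
- by rewrite size_sort size_map size_enum_ord prednK.
- by apply: sort_sorted => x y; exact: le_total.
rewrite prednK// count_sort count_map cardsE cardE -size_filter.
rewrite /enum_mem -filter_predI; congr (_ <= size _)%N.
by apply: eq_filter => l /=; rewrite andbT.
Qed.

(** The subsets are grouped by cardinality. Here [J] stands for the set of observations at or below
    a threshold. *)
Lemma binomial_tail_subsets k n (p : R) :
  \sum_(J : {set 'I_n} | (k <= #|J|)%N) p ^+ #|J| * (1 - p) ^+ (n - #|J|) =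
  (binomial_tail k n).[p].
Proof.
rewrite binomial_tail_horner big_geq_mkord.
have card_lt (J : {set 'I_n}) : (#|J| < n.+1)%N.
  by rewrite ltnS -[leqRHS]card_ord max_card.
rewrite (partition_big (fun J : {set 'I_n} => Ordinal (card_lt J))
  (fun l : 'I_n.+1 => k <= l)%N)//=.
apply: eq_bigr => l kl.
rewrite (eq_bigr (fun=> p ^+ l * (1 - p) ^+ (n - l))); last first.
  by move=> J /andP[_ /eqP <-].
rewrite sumr_const -[LHS]mulr_natl; congr (_%:R * _).
have := card_draws 'I_n l; rewrite card_ord => <-.
rewrite cardsE; apply: eq_card => J.
rewrite !unfold_in -val_eqE /= -[RHS]/(#|J| == l).
by case: eqP => [->|_]; rewrite ?kl ?andbF.
Qed.

Context d {T : measurableType d} {P : probability T R}.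
Variables (n : nat) (Xs : 'I_n -> {RV P >-> R}) (F : R -> R).
Hypothesis HXs : iid_sample Xs F.

Let region (t : R) (J : {set 'I_n}) (l : 'I_n) : set R :=
  if l \in J then `]-oo, t]%classic else ~` `]-oo, t].

(** The observations at most [t] are exactly those indexed by [J]. The full index set is spelled as
    a finite set to match [mutually_independent]. *)
Let event t J := \bigcap_(l in [set l | l \in [set: 'I_n]%SET])
  (Xs l @^-1` region t J l).

Let measurable_region t J l : measurable (region t J l).
Proof. by rewrite /region; case: ifP => _ //; exact: measurableC. Qed.

Let measurable_event t J : measurable (event t J).
Proof.
apply: fin_bigcap_measurable => // l _.
exact: measurable_funPTI.
Qed.

Let event_eq t J w : event t J w -> J = [set l | Xs l w <= t]%SET.
Proof.
move=> h; apply/setP => l; rewrite inE.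
have := h l; rewrite /= inE => /(_ isT); rewrite /region.
by case: ifP => _; rewrite /= in_itv /=; [move=> ->|move=> /negP/negbTE ->].
Qed.

Let probability_event t J :
  P (event t J) = (F t ^+ #|J| * (1 - F t) ^+ (n - #|J|))%:E.
Proof.
have [Hind HF] := HXs.
have PF l : P (Xs l @^-1` `]-oo, t]) = (F t)%:E.
  by rewrite -(HF l) fineK// fin_num_measure.
have PFC l : P (Xs l @^-1` (~` `]-oo, t])) = (1 - F t)%:E.
  rewrite preimage_setC probability_setC ?PF//.
  exact: (measurable_funPTI (Xs l) (measurable_itv `]-oo, t])).

rewrite /event Hind//.
rewrite (eq_bigr (fun l => (if l \in J then F t else 1 - F t)%:E)); last first.
  by move=> l _; rewrite /region; case: ifP => _; [exact: PF|exact: PFC].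
rewrite prodEFin; congr EFin.
rewrite (eq_bigl xpredT); last by move=> l; rewrite inE.
rewrite (bigID (mem J)) /=; congr (_ * _).
  by rewrite (eq_bigr (fun=> F t)) ?prodr_const// => l ->.
rewrite (eq_bigr (fun=> 1 - F t)); last by move=> l /negbTE ->.
rewrite prodr_const; congr (_ ^+ _).
have -> : #|[pred l | l \notin J]| = (#|'I_n| - #|J|)%N.
  by rewrite -(cardC (mem J)) addKn; apply: eq_card.
by rewrite card_ord.
Qed.

Let order_stat_event k t : (0 < k <= n)%N ->
  (order_stat (fun l => Xs l : T -> R) k) @^-1` `]-oo, t] =
  \bigcup_(J in [set J : {set 'I_n} | (k <= #|J|)%N]) event t J.
Proof.
move=> kn; apply/seteqP; split=> w /=; rewrite in_itv /= order_stat_le//.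
  move=> h; exists [set l | Xs l w <= t]%SET => // l _.
  rewrite /region inE /=; case: ifPn; rewrite /= in_itv /=; first by [].
  by move/negP.
by move=> [J kJ /event_eq JE]; rewrite -JE.
Qed.

Lemma measurable_order_stat k : (0 < k <= n)%N ->
  measurable_fun [set: T] (order_stat (fun l => Xs l : T -> R) k).
Proof.
move=> kn; apply: (measurability _ (RGenOInfty.measurableE R)) => //.
move=> _ [_ [t ->] <-]; rewrite setTI -setCitvl preimage_setC.
have mE : measurable (order_stat (fun l => Xs l : T -> R) k @^-1` `]-oo, t]).
  rewrite order_stat_event//.
  by apply: fin_bigcup_measurable => // J _; exact: measurable_event.
exact: measurableC mE.
Qed.

(** The event is a disjoint union over the index sets with at least [k] elements, whose
    probabilities add up to a binomial tail. *)
Lemma probability_order_stat_le k t : (0 < k <= n)%N ->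
  P ((order_stat (fun l => Xs l : T -> R) k) @^-1` `]-oo, t]) =
  (binomial_tail k n).[F t]%:E.
Proof.
move=> kn; rewrite order_stat_event// measure_fin_bigcup//.
- rewrite (@fsbigE _ _ _ _ _ (enum [pred J : {set 'I_n} | (k <= #|J|)%N])).
  + rewrite big_enum_cond -binomial_tail_subsets -sumEFin.
    apply: eq_big => [J|J _]; last exact: probability_event.
    by rewrite !inE /=; case: leqP => //= kJ; rewrite mem_set.
  + exact: enum_uniq.
  + by move=> J /=; rewrite mem_enum inE.
  + by move=> J /= kJ; rewrite mem_enum inE kJ.
- exact: finite_finset.
- by move=> J K _ _ [w [/event_eq -> /event_eq ->]].
Qed.

End order_statistics.

(** * Quantile transform *)

Section quantile.
Context {R : realType} {d : measure_display} {T : measurableType d}.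
Context {P : probability T R} (X : {RV P >-> R}) (F : R -> R).
Hypothesis X_ge0 : forall w, 0 <= X w.
Hypothesis FE : forall x, F x = fine (cdf X x).

Let F_nd x y : x <= y -> F x <= F y.
Proof.
by move=> xy; rewrite !FE fine_le ?fin_num_measure// cdf_nondecreasing.
Qed.

Let F_lt0 x : x < 0 -> F x = 0.
Proof.
move=> x0; rewrite FE /cdf /distribution /pushforward.
rewrite (_ : X @^-1` _ = set0) ?measure0//.
apply/seteqP; split=> // w /=; rewrite in_itv /= => Xwx.
by have := le_lt_trans (le_trans (X_ge0 w) Xwx) x0; rewrite ltxx.
Qed.

Let F_rc t : F x @[x --> t^'+] --> F t.
Proof.
rewrite (_ : F = fine \o cdf X); last by apply/funext => x; rewrite FE.
by apply: fine_cvg; rewrite fineK ?fin_num_measure//; exact: cdf_right_continuous.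
Qed.

Let F_gt p : p < 1 -> exists x, p < F x.
Proof.
move=> p1; have /fine_cvg F1 := cvg_cdfy1 X.
have [x /= px] := filter_ex (cvgr_gt _ F1 _ p1).
by exists x; rewrite FE.
Qed.

(** Galois connection between quantile and CDF; right continuity of [F] makes the infimum
    attained. *)
Lemma quantile_le p t : 0 < p < 1 -> (quantile F p <= t) = (p <= F t).
Proof.
move=> /andP[p0 p1].
have lb0 : lbound [set x | p <= F x] 0.
  move=> x /= px; rewrite leNgt; apply/negP => x0.
  by move: px; rewrite F_lt0// leNgt p0.
have nonempty : [set x | p <= F x] !=set0.
  by have [x /ltW px] := F_gt p1; exists x.
apply/idP/idP => [qt|pt]; last by apply: ge_inf => //; exists 0.
rewrite leNgt; apply/negP => Ftp.
have [x [tx /= xp]] : exists x, t < x /\ F x < p.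
  apply: (@filter_ex _ (t^'+)); apply: filterI; first exact: nbhs_right_gt.
  exact: (cvgr_lt _ (@F_rc t)).
have [y /= py yx] := inf_lt nonempty (le_lt_trans qt tx).
by have := lt_le_trans xp (le_trans py (F_nd (ltW yx))); rewrite ltxx.
Qed.

Lemma quantile_ge0 p : 0 < p < 1 -> 0 <= quantile F p.
Proof.
move=> p01; rewrite leNgt; apply/negP => qp.
have := quantile_le (quantile F p) p01.
by rewrite lexx F_lt0// leNgt; case/andP: p01 => ->.
Qed.

Let F01 t : 0 <= F t <= 1.
Proof.
rewrite FE fine_ge0 ?cdf_ge0//= -lee_fin fineK ?fin_num_measure//.
exact: cdf_le1.
Qed.

(* At [p >= 1] the infimum may be over the empty set, and for [p <= 0] it is over
   all of [R]; both give the junk value [inf _ = 0], so the quantile function is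
   only used on (0,1), which has full beta measure. *)
Definition quantile01 p := if 0 < p < 1 then quantile F p else 0.

Lemma quantile01_ge0 p : 0 <= quantile01 p.
Proof. by rewrite /quantile01; case: ifPn => // /quantile_ge0. Qed.

Let quantile01_le t : 0 <= t ->
  quantile01 @^-1` `]-oo, t] = ~` `]0, 1[ `|` `]-oo, F t].
Proof.
move=> t0; apply/seteqP; split=> p /=; rewrite /quantile01 !in_itv /=.
  by case: ifPn => p01; [rewrite quantile_le//; right|left].
by case: ifPn => p01; [rewrite quantile_le//; case|rewrite t0].
Qed.

Lemma measurable_quantile01 : measurable_fun [set: R] quantile01.
Proof.
apply: (measurability _ (RGenOInfty.measurableE R)) => //.
move=> _ [_ [t ->] <-]; rewrite setTI -setCitvl preimage_setC.
have mE : measurable (quantile01 @^-1` `]-oo, t]).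
  have [t0|t0] := leP 0 t.
    by rewrite quantile01_le//; apply: measurableU => //; exact: measurableC.
  rewrite (_ : _ @^-1` _ = set0)//; apply/seteqP; split=> // p /=.
  by rewrite in_itv /= leNgt (lt_le_trans t0)// quantile01_ge0.
exact: measurableC mE.
Qed.

(** Quantile transform: for [0 <= t] the Galois connection makes the preimage the ray below [F t],
    up to the complement of (0,1), which is null. *)
Lemma beta_prob_quantile01_le k N t : (0 < k <= N)%N ->
  beta_prob k (N - k + 1) (quantile01 @^-1` `]-oo, t]) =
  (binomial_tail k N).[F t]%:E.
Proof.
move=> kN; have [t0|t0] := leP 0 t; last first.
  rewrite F_lt0// binomial_tail_horner0; last by case/andP: kN.
  rewrite (_ : _ @^-1` _ = set0) ?measure0//; apply/seteqP; split=> // p /=.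
  by rewrite in_itv /= leNgt (lt_le_trans t0)// quantile01_ge0.
rewrite -(beta_prob_le kN (F01 t)) quantile01_le//.
have mle : measurable (`]-oo, F t] : set R) by [].
apply/eqP; rewrite eq_le; apply/andP; split; last first.
  apply: le_measure; rewrite ?inE//.
  by apply: measurableU => //; exact: measurableC.
have nullC : beta_prob k (N - k + 1) (~` `]0, 1[ : set R) = 0.
  have /andP[k0 kleN] := kN.
  have b01 : beta_prob k (N - k + 1) (`]0, 1[ : set R) = 1%E.
    rewrite beta_prob_itv// binomial_tail_horner0// binomial_tail_horner1//.
    by rewrite subr0.
  have := probability_setC (beta_prob k (N - k + 1)) (measurable_itv `]0, 1[).
  by move=> ->; rewrite [X in (1 - X)%E]b01 -EFinB subrr.
by rewrite (le_trans (measureU2 _ _ _))//= ?nullC ?add0e//; exact: measurableC.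
Qed.

End quantile.

(** * Comparison of expectations *)

Section law.
Context {R : realType} d1 d2 {T1 : measurableType d1} {T2 : measurableType d2}.
Context {P1 : probability T1 R} {P2 : probability T2 R}.
Variables (V : {RV P1 >-> R}) (W : {RV P2 >-> R}).

(** Open right rays form a generating pi-system that exhausts the line. *)
Lemma eq_cdf_distribution (A : set R) : (forall t, cdf V t = cdf W t) ->
  measurable A -> distribution P1 V A = distribution P2 W A.
Proof.
move=> eqcdf.
have mG : @measurable _ R = <<s @RGenOInfty.G R >>.
  exact: RGenOInfty.measurableE.
apply: (measure_unique (@RGenOInfty.G R)
  (fun n => `](- n%:R)%R, +oo[%classic) mG).
- move=> _ _ [x ->] [y ->]; exists (Num.max x y).
  apply/seteqP; split=> z /=; rewrite !in_itv /= !andbT gt_max.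
    by move=> [-> ->].
  by move=> /andP.
- by move=> n; exists (- n%:R).
- apply/seteqP; split=> // z _; exists (Num.truncn `|z|).+1 => //=.
  rewrite in_itv /= andbT ltrNl.
  by rewrite (le_lt_trans (ler_norm _))// normrN truncnS_gt.
- move=> _ [x ->].
  by rewrite -[LHS]/(ccdf V x) -[RHS]/(ccdf W x) !ccdf_1_cdf eqcdf.
- by move=> n; rewrite -ge0_fin_numE// fin_num_measure.
Qed.

Lemma eq_cdf_ge0_integral (f : R -> \bar R) :
  (forall t, cdf V t = cdf W t) -> measurable_fun setT f ->
  (forall x, 0 <= f x)%E ->
  (\int[P1]_w f (V w) = \int[P2]_w f (W w))%E.
Proof.
move=> eqcdf mf f0.
rewrite -(ge0_integral_distribution V mf f0) -(ge0_integral_distribution W mf f0).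
by apply: eq_measure_integral => A mA _; exact: eq_cdf_distribution.
Qed.

End law.

(** * Layer-cake comparison of integrals *)

Section tail_comparison.
Context {R : realType} d {T : measurableType d}.
Local Open Scope ereal_scope.
Implicit Types (P Q : probability T R) (h : T -> R).

Let tail_ccdf P h (mh : measurable_fun setT h) :
  exists2 hP : {RV P >-> R}, hP = h :> (T -> R) &
    forall s, P [set w | (s < h w)%R] = ccdf hP s.
Proof.
exists (HB.pack h (isMeasurableFun.Build _ _ _ _ h mh) : {RV P >-> R}) => // s.
rewrite /ccdf /distribution /pushforward.
by congr (P _); apply/seteqP; split=> w /=; rewrite in_itv /= andbT.
Qed.

Lemma measurable_tail P h : measurable_fun setT h ->
  measurable_fun [set: R] (fun s => P [set w | (s < h w)%R]).
Proof.
move=> /(@tail_ccdf P)[hP _ hPE]; apply: (eq_measurable_fun (ccdf hP)).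
  by move=> s _; rewrite hPE.
exact: ccdf_measurable.
Qed.

Lemma ge0_integral_tail P h : measurable_fun setT h ->
  (forall w, 0 <= h w)%R ->
  \int[P]_w (h w)%:E =
  \int[lebesgue_measure]_(s in `[0%R, +oo[) P [set w | (s < h w)%R].
Proof.
move=> /(@tail_ccdf P)[hP hE hPE] h0.
rewrite -hE; have := @ge0_expectation_ccdf _ _ _ P hP.
rewrite expectation_def hE => ->//.
by apply: eq_integral => s _; rewrite hPE.
Qed.

(** The layer-cake formula turns both sides into integrals over the level [s], compared
    pointwise. *)
Lemma le_ge0_integral_tail P Q h (a b : R) :
  measurable_fun setT h -> (forall w, 0 <= h w)%R -> (0 <= a)%R -> (0 <= b)%R ->
  (forall s, (0 <= s)%R ->
    b%:E * Q [set w | (s < h w)%R] <= a%:E * P [set w | (s < h w)%R]) ->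
  b%:E * \int[Q]_w (h w)%:E <= a%:E * \int[P]_w (h w)%:E.
Proof.
move=> mh h0 a0 b0 PQ; rewrite !ge0_integral_tail//.
have mt P' : measurable_fun (`[0%R, +oo[ : set R)
    (fun s => P' [set w | (s < h w)%R]).
  by apply: measurable_funTS; exact: (measurable_tail P' mh).
have Z (c : R) P' : (0 <= c)%R ->
    c%:E * \int[lebesgue_measure]_(s in `[0%R, +oo[) P' [set w | (s < h w)%R] =
    \int[lebesgue_measure]_(s in `[0%R, +oo[) (c%:E * P' [set w | (s < h w)%R]).
  by move=> c0; rewrite ge0_integralZl//; exact: mt.
rewrite !Z//; apply: ge0_le_integral => //.
- by move=> s _; rewrite mule_ge0.
- by apply: measurable_funeM; exact: mt.
- by apply: measurable_funeM; exact: mt.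
- by move=> s /=; rewrite in_itv /= andbT => /PQ.
Qed.

End tail_comparison.

Section upset.
Context {R : realType}.

Lemma upset_itv01 (A : set R) : A `<=` `]0, 1[ ->
  (forall x y, A x -> x <= y -> y < 1 -> A y) -> A !=set0 ->
  exists b x, 0 <= x < 1 /\ A = [set` Interval (BSide b x) (BLeft 1)].
Proof.
move=> A01 Aup A0.
have A_gt0 y : A y -> 0 <= y by move/A01; rewrite /= in_itv /= => /andP[/ltW].
have A_lt1 y : A y -> y < 1 by move/A01; rewrite /= in_itv /= => /andP[].
have infA y : A y -> inf A <= y by apply: ge_inf; exists 0.
(* The left end is the infimum, closed exactly when it belongs to [A]. *)
exists (inf A \in A), (inf A); split.
  have [y Ay] := A0.
  by rewrite lb_le_inf//= (le_lt_trans (infA _ Ay))// A_lt1.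
apply/seteqP; split=> y /=; rewrite in_itv /= /Order.lteif.
  move=> Ay; rewrite A_lt1// andbT; case: ifPn => nA; first exact: infA.
  rewrite lt_neqAle infA// andbT; apply: contraNneq nA => ->.
  exact: mem_set.
move=> /andP[+ y1]; case: ifPn => [/set_mem AiA iy|_ iy]; first exact: Aup iy y1.
by have [z Az /ltW zy] := inf_lt A0 iy; exact: Aup zy y1.
Qed.

End upset.

Section star_shaped_functions.
Context {R : realType}.
Variables (u : R -> R) (u_ss : star_shaped u).

(** For positive [x], [u x] is the product of [u x / x] and [x], both non-negative and
    non-decreasing. *)
Lemma star_shaped_nd x y : 0 <= x -> x <= y -> u x <= u y.
Proof.
have [u0 u_ge0 u_incr] := u_ss; rewrite le_eqVlt => /predU1P[<- y0|x0 xy].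
  by rewrite u0 u_ge0.
have y0 := lt_le_trans x0 xy.
rewrite -(divfK (lt0r_neq0 x0) (u x)) -(divfK (lt0r_neq0 y0) (u y)).
apply: ler_pM => //; [|exact: ltW|exact: u_incr].
by rewrite divr_ge0 ?u_ge0// ltW.
Qed.

Lemma measurable_star_shaped :
  measurable_fun [set: R] (fun x => if 0 <= x then u x else 0).
Proof.
have [u0 u_ge0 _] := u_ss.
apply: nondecreasing_measurable => // x y xy.
case: (leP 0 x) => x0; first by rewrite (le_trans x0 xy) star_shaped_nd.
by case: ifPn => // /u_ge0.
Qed.

End star_shaped_functions.

(** * Star-shaped functions of order statistics *)

Section quantile_expectation.
Context {R : realType} {d0 : measure_display} {T0 : measurableType d0}.
Context {P0 : probability T0 R} (X : {RV P0 >-> R}) (F : R -> R).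
Hypothesis X_ge0 : forall w, 0 <= X w.
Hypothesis FE : forall x, F x = fine (cdf X x).
Variables (u : R -> R) (u_ss : star_shaped u).

(** The [h] of the overview, extended by 0 outside (0,1) through [quantile01] and [u 0 = 0]. *)
Definition star_ratio p := u (quantile01 F p) / p.

Let q_ge0 p : 0 <= quantile01 F p.
Proof. exact: quantile01_ge0 X_ge0 FE p. Qed.

Let q_out p : ~~ (0 < p < 1) -> quantile01 F p = 0.
Proof. by rewrite /quantile01 => /negbTE ->. Qed.

Lemma star_ratio_out p : ~~ (0 < p < 1) -> star_ratio p = 0.
Proof.
move=> /q_out p01; rewrite /star_ratio p01.
by case: u_ss => -> _ _; rewrite mul0r.
Qed.

Lemma star_ratio_ge0 p : 0 <= star_ratio p.
Proof.
case: (boolP (0 < p < 1)) => [/andP[p0 _]|/star_ratio_out ->//].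
by case: u_ss => _ u0 _; rewrite divr_ge0 ?u0// ltW.
Qed.

Lemma mul_star_ratio p : p * star_ratio p = u (quantile01 F p).
Proof.
case: (boolP (0 < p < 1)) => [/andP[p0 _]|p01].
  by rewrite mulrC divfK// gt_eqF.
by rewrite star_ratio_out// q_out// mulr0; case: u_ss.
Qed.

Hypothesis F_DDA : DDA F.

(** For a positive quantile q, u(q)/p is the product of u(q)/q and q/p, both non-decreasing in p. A
    zero quantile is treated apart, since the factorisation divides by it. *)
Lemma star_ratio_nd x y : 0 < x -> x <= y -> y < 1 ->
  star_ratio x <= star_ratio y.
Proof.
move=> x0 xy y1; have y0 := lt_le_trans x0 xy; have x1 := le_lt_trans xy y1.
have [u0 u_ge0 u_incr] := u_ss.
have qxy : quantile01 F x / x <= quantile01 F y / y.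
  by rewrite /quantile01 x0 x1 y0 y1; exact: F_DDA.
have := q_ge0 x; rewrite le_eqVlt => /predU1P[qx0|qx].
  by rewrite {1}/star_ratio -qx0 u0 mul0r star_ratio_ge0.
have qxqy : quantile01 F x <= quantile01 F y.
  rewrite -(divfK (lt0r_neq0 x0) (quantile01 F x)).
  rewrite -(divfK (lt0r_neq0 y0) (quantile01 F y)).
  by apply: ler_pM => //; [rewrite divr_ge0// ltW|exact: ltW].
have qy := lt_le_trans qx qxqy.
rewrite /star_ratio -(divfK (lt0r_neq0 qx) (u (quantile01 F x))).
rewrite -(divfK (lt0r_neq0 qy) (u (quantile01 F y))).
rewrite -[leLHS]mulrA -[leRHS]mulrA.
by apply: ler_pM => //; [rewrite divr_ge0 ?u_ge0// ltW|
  rewrite divr_ge0// ltW|exact: u_incr].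
Qed.

Let superlevel s : 0 <= s -> [set p | s < star_ratio p] `<=` `]0, 1[.
Proof.
move=> s0 p /= sp; rewrite in_itv /=; apply: contraTT sp.
by move=> /star_ratio_out ->; rewrite -leNgt.
Qed.

Lemma star_ratio_superlevel s : 0 <= s ->
  [set p | s < star_ratio p] = set0 \/
  exists b x, 0 <= x < 1 /\
    [set p | s < star_ratio p] = [set` Interval (BSide b x) (BLeft 1)].
Proof.
move=> s0; have [->|/set0P nonempty] := eqVneq [set p | s < star_ratio p] set0.
  by left.
right; apply: upset_itv01 => //; first exact: superlevel.
move=> x y /= sx xy y1; apply: (lt_le_trans sx); apply: star_ratio_nd => //.
by have := superlevel s0 sx; rewrite /= in_itv /= => /andP[].
Qed.

Lemma measurable_star_ratio : measurable_fun [set: R] star_ratio.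
Proof.
apply: (measurability _ (RGenOInfty.measurableE R)) => //.
move=> _ [_ [s ->] <-]; rewrite setTI.
have mE : measurable ([set p | s < star_ratio p] : set R).
  have [s0|s0] := leP 0 s.
    by have [->|[b [x [_ ->]]]] := star_ratio_superlevel s0.
  rewrite (_ : mkset _ = setT)//; apply/seteqP; split=> // p _ /=.
  exact: lt_le_trans s0 (star_ratio_ge0 p).
rewrite (_ : _ @^-1` _ = [set p | s < star_ratio p])//.
by apply/seteqP; split=> p /=; rewrite in_itv /= andbT.
Qed.

(** The order statistic has the law of [quantile01 F] under beta(i, n-i+1). Writing the integrand as
    [p * star_ratio p] allows size biasing. *)
Lemma integral_star_shaped_order_stat d (T : measurableType d)
    (P : probability T R) n i (Xs : 'I_n -> {RV P >-> R}) :
  iid_sample Xs F -> (0 < i <= n)%N ->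
  P.-integrable setT
    (fun w => (u (order_stat (fun k => Xs k : T -> R) i w))%:E) ->
  (\int[P]_w (u (order_stat (fun k => Xs k : T -> R) i w))%:E =
   (i%:R / n.+1%:R)%:E *
     \int[beta_prob i.+1 (n - i + 1)]_p (star_ratio p)%:E)%E.
Proof.
move=> HXs hi iu.
set V := order_stat _ i; have mV := measurable_order_stat Xs hi.
pose VV : {RV P >-> R} := HB.pack V (isMeasurableFun.Build _ _ _ _ V mV).
pose B := @beta_prob R i (n - i + 1).
have mq := measurable_quantile01 X_ge0 FE.
pose Q : {RV B >-> R} := HB.pack (quantile01 F : measurableTypeR R -> R)
  (@isMeasurableFun.Build _ _ (measurableTypeR R) R (quantile01 F) mq).
have eqcdf t : cdf VV t = cdf Q t.
  rewrite [LHS](probability_order_stat_le HXs t hi).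
  by rewrite [RHS](beta_prob_quantile01_le X_ge0 FE t hi).
pose u' (x : R) := (if 0 <= x then u x else 0)%:E.
have mu' : measurable_fun setT u'.
  by apply/measurable_EFinP; exact: measurable_star_shaped.
have u'0 x : (0 <= u' x)%E.
  by rewrite /u' lee_fin; case: u_ss => _ u_ge0 _; case: ifPn => // /u_ge0.
have V_lt0 : [set w | V w < 0] = V @^-1` `]-oo, 0[.
  by apply/seteqP; split=> w /=; rewrite in_itv.
have V_null : P [set w | V w < 0] = 0%E.
  rewrite V_lt0.
  have := eq_cdf_distribution eqcdf (measurable_itv `]-oo, 0[).
  rewrite /distribution /pushforward => ->.
  rewrite (_ : _ @^-1` _ = set0) ?measure0//.
  by apply/seteqP; split=> // p /=; rewrite in_itv /= ltNge q_ge0.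
(* [u] is unconstrained on negative reals, so [u] itself need not be measurable,
   but [V] is non-negative almost surely. *)
rewrite (ae_eq_integral (u' \o V))//; last 3 first.
- exact: measurable_int iu.
- exact: measurableT_comp.
- exists [set w | V w < 0]; split=> //.
    rewrite V_lt0 -[X in measurable X]setTI.
    exact: mV measurableT _ (measurable_itv `]-oo, 0[).
  move=> w /= /not_implyP[_]; rewrite /u' ltNge.
  by case: ifPn.
rewrite [LHS](eq_cdf_ge0_integral (W := Q) eqcdf mu' u'0).
rewrite -(ge0_integral_beta_probX hi measurable_star_ratio); last 2 first.
- by move=> x _; exact: star_ratio_ge0.
- by move=> x x0; apply: star_ratio_out; rewrite ltNge x0.
by apply: eq_integral => p _; rewrite mul_star_ratio /u' q_ge0.
Qed.

(** On an interval from [x] to 1 the difference of the two weighted masses is exactly the gap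
    polynomial at [x]. *)
Lemma beta_prob_superlevel_le n m i j s : (0 < i <= n)%N -> (0 < j <= m)%N ->
  (forall x : R, 0 <= x <= 1 -> 0 <= (tail_moment_gap n m i j).[x]) ->
  0 <= s ->
  ((j%:R / m.+1%:R)%:E *
     beta_prob j.+1 (m - j + 1) [set p | (s < star_ratio p)%R] <=
   (i%:R / n.+1%:R)%:E *
     beta_prob i.+1 (n - i + 1) [set p | (s < star_ratio p)%R])%E.
Proof.
move=> hi hj gap s0.
have [->|[b [x [/andP[x0 x1] ->]]]] := star_ratio_superlevel s0.
  by rewrite !measure0 !mule0.
have hi1 : (0 < i.+1 <= n.+1)%N by case/andP: hi.
have hj1 : (0 < j.+1 <= m.+1)%N by case/andP: hj.
rewrite (@beta_prob_itv _ i.+1 n.+1)// (@beta_prob_itv _ j.+1 m.+1)//.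
have := gap x; rewrite x0 ltW// => /(_ isT).
rewrite /tail_moment_gap !hornerE !binomial_tail_horner1//.
by rewrite -!EFinM lee_fin -subr_ge0.
Qed.

End quantile_expectation.

(** Dividing the equality of the two densities by powers of r and 1-r gives the equation of the
    theorem. Exponents may be negative, hence the integer powers. *)
Lemma eq_deriv_binomial_tail (R : realType) n m i j (r : R) :
  (0 < i <= n)%N -> (0 < j <= m)%N -> 0 < r < 1 ->
  (binomial_tail i n)^`().[r] = (binomial_tail j m)^`().[r] ->
  r ^ (i%:Z - j%:Z) * (1 - r) ^ ((n%:Z - i%:Z) - (m%:Z - j%:Z)) =
  beta_fun i (n - i + 1) / beta_fun j (m - j + 1).
Proof.
move=> hi hj /andP[r0 r1]; rewrite !deriv_binomial_tail// !hornerE /=.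
rewrite -!beta_funV//.
have /andP[i0 ilen] := hi; have /andP[j0 jlem] := hj.
have rn0 : r != 0 by rewrite gt_eqF.
have r1n0 : 1 - r != 0 by rewrite subr_eq0 gt_eqF.
have -> : i%:Z - j%:Z = i.-1%:Z - j.-1%:Z by lia.
rewrite (subzn ilen) (subzn jlem) !expfzDr// -!exprnN -!exprnP => h.
rewrite -!mulrA in h.
have Bi : beta_fun i (n - i + 1) != 0 :> R by rewrite gt_eqF// beta_fun_gt0.
have Bj : beta_fun j (m - j + 1) != 0 :> R by rewrite gt_eqF// beta_fun_gt0.
rewrite mulrACA -invfM; apply/eqP; rewrite eqr_div ?mulf_neq0 ?expf_neq0//.
rewrite -(inj_eq (mulfI (mulf_neq0 (invr_neq0 Bi) (invr_neq0 Bj)))).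
apply/eqP; transitivity
  ((beta_fun i (n - i + 1))^-1 * (r ^+ i.-1 * (1 - r) ^+ (n - i))).
  by field; rewrite Bi.
by rewrite h; field; rewrite Bj.
Qed.

Theorem theorem15 (R : realType)
  (d0 : measure_display) (T0 : measurableType d0) (P0 : probability T0 R)
  (X : {RV P0 >-> R}) (F : R -> R)
  (HX : forall w, 0 <= X w)
  (HF : forall x, F x = fine (cdf X x))
  (HDDA : DDA F)
  (n m i j : nat)
  (Hi : (1 <= i <= n)%N) (Hj : (1 <= j <= m)%N)
  (d1 : measure_display) (T1 : measurableType d1) (P1 : probability T1 R)
  (Xs : 'I_n -> {RV P1 >-> R}) (HXs : iid_sample Xs F)
  (d2 : measure_display) (T2 : measurableType d2) (P2 : probability T2 R)
  (Ys : 'I_m -> {RV P2 >-> R}) (HYs : iid_sample Ys F)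
  (HZ : forall r : R, 0 < r < 1 ->
     r ^ (i%:Z - j%:Z) * (1 - r) ^ ((n%:Z - i%:Z) - (m%:Z - j%:Z))
       = beta_fun i (n - i + 1) / beta_fun j (m - j + 1) ->
     0 <= Zfun n m i j r) :
  ss_ge P1 (order_stat (fun k => Xs k : T1 -> R) i)
        P2 (order_stat (fun k => Ys k : T2 -> R) j).
Proof.
move=> u u_ss iV iW.
rewrite (integral_star_shaped_order_stat HX HF u_ss HDDA HXs Hi iV).
rewrite (integral_star_shaped_order_stat HX HF u_ss HDDA HYs Hj iW).
(* Both sides now integrate the same [star_ratio], so comparing the masses of its superlevel sets is
   enough. *)
apply: le_ge0_integral_tail.
- exact: measurable_star_ratio HX HF _ u_ss HDDA.
- exact: star_ratio_ge0 HX HF _ u_ss.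
- by rewrite divr_ge0.
- by rewrite divr_ge0.
move=> s s0; apply: (beta_prob_superlevel_le HX HF u_ss HDDA Hi Hj _ s0).
(* Only points where the densities agree remain; they solve the equation of the statement, so [HZ]
   applies. *)
apply: tail_moment_gap_ge0 => // r r01 dr.
have := HZ r r01 (eq_deriv_binomial_tail Hi Hj r01 dr).
have r01' : 0 <= r <= 1 by case/andP: r01 => /ltW -> /ltW ->.
have Hi1 : (0 < i.+1 <= n.+1)%N by case/andP: Hi.
have Hj1 : (0 < j.+1 <= m.+1)%N by case/andP: Hj.
rewrite /Zfun /beta_cdf !beta_prob_le//= /tail_moment_gap.
by rewrite !(hornerD, hornerN, hornerZ, hornerC).
Qed.
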